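(* Consider the single stage pricing game with linear loyalty described in the context, with parameters $c_A\ge c_B\ge 0$, $l_\alpha,l_\beta>0$, $s_\alpha,s_\beta\ge 0$, $\theta\in(0,1)$, and $F$ the distribution function of the uniform distribution on $[0,1]$. Suppose (Region II) $$\max(l_\beta-s_\beta,\;s_\alpha-l_\alpha)\le c_A-c_B\le s_\alpha+2l_\alpha .$$ Then the game has a unique pure Nash equilibrium, and its prices are $$p_A^\alpha=\tfrac13(2c_A+c_B+s_\alpha+2l_\alpha),\quad p_A^\beta=c_A,\quad p_B^\beta=c_A+s_\beta,\quad p_B^\alpha=\tfrac13(c_A+2c_B-s_\alpha+l_\alpha) .$$
   Context: Two firms $A$ and $B$ sell the same product, with unit product costs $c_A$ and $c_B$, where $c_A\ge c_B\ge 0$. Customers are partitioned into a set $\alpha$ (ex ante loyal to $A$; a fraction $\theta$ of the market; $A$'s strong and $B$'s weak sub-market) and a set $\beta$ (ex ante loyal to $B$; a fraction $1-\theta$; $B$'s strong and $A$'s weak sub-market). Both firms can tell the two sets apart. Each customer buys exactly one unit, from $A$ or from $B$. Firms move simultaneously: $A$ chooses $(p_A^\alpha,p_A^\beta)$ with $p_A^\alpha,p_A^\beta\ge c_A$, and $B$ chooses $(p_B^\beta,p_B^\alpha)$ with $p_B^\beta,p_B^\alpha\ge c_B$; the superscript is the set of customers to which the price is offered. Linear loyalty: a customer in $\alpha$ has loyalty level $l_\alpha\xi+s_\alpha$ and buys from $A$ iff $l_\alpha\xi+s_\alpha\ge p_A^\alpha-p_B^\alpha$; a customer in $\beta$ has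 loyalty level $l_\beta\xi+s_\beta$ and buys from $B$ iff $l_\beta\xi+s_\beta\ge p_B^\beta-p_A^\beta$; here $\xi$ is random with distribution function $F$. Put $\xi^\alpha=(p_A^\alpha-p_B^\alpha-s_\alpha)/l_\alpha$ and $\xi^\beta=(p_B^\beta-p_A^\beta-s_\beta)/l_\beta$. For the uniform distribution, $F(x)=0$ for $x\le 0$, $F(x)=x$ for $0\le x\le1$, $F(x)=1$ for $x\ge1$. Profits: firm $A$ gets $(p_A^\alpha-c_A)\,\theta\,(1-F(\xi^\alpha))+(p_A^\beta-c_A)(1-\theta)F(\xi^\beta)$; firm $B$ gets $(p_B^\beta-c_B)(1-\theta)(1-F(\xi^\beta))+(p_B^\alpha-c_B)\,\theta\,F(\xi^\alpha)$. A pure Nash equilibrium is a price profile $(p_A^\alpha,p_A^\beta,p_B^\beta,p_B^\alpha)$ from which neither firm can strictly increase its profit by unilaterally changing its own (feasible) prices. *)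

(* Defs.v *)
From Stdlib Require Export Reals.
Open Scope R_scope.

(* Names: [a] is the set alpha (loyal to A), [b] the set beta (loyal to B);
   [pAb] is the price that firm A offers to the customers in beta, and so on. *)

Record market : Type := Market {
  cA : R; cB : R;
  theta : R;
  la : R; sa : R;  (* loyalty level la * xi + sa on alpha *)
  lb : R; sb : R   (* loyalty level lb * xi + sb on beta *)
}.

Record strategyA : Type := StrategyA { pAa : R; pAb : R }.
Record strategyB : Type := StrategyB { pBb : R; pBa : R }.

Definition feasibleA (m : market) (x : strategyA) : Prop :=
  cA m <= pAa x /\ cA m <= pAb x.

Definition feasibleB (m : market) (y : strategyB) : Prop :=
  cB m <= pBb y /\ cB m <= pBa y.

(* An alpha customer buys from A iff xi >= xi_a; a beta customer buys from B
   iff xi >= xi_b. *)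
Definition xi_a (m : market) (x : strategyA) (y : strategyB) : R :=
  (pAa x - pBa y - sa m) / la m.

Definition xi_b (m : market) (x : strategyA) (y : strategyB) : R :=
  (pBb y - pAb x - sb m) / lb m.

Definition profitA (F : R -> R) (m : market)
    (x : strategyA) (y : strategyB) : R :=
  (pAa x - cA m) * theta m * (1 - F (xi_a m x y))
  + (pAb x - cA m) * (1 - theta m) * F (xi_b m x y).

Definition profitB (F : R -> R) (m : market)
    (x : strategyA) (y : strategyB) : R :=
  (pBb y - cB m) * (1 - theta m) * (1 - F (xi_b m x y))
  + (pBa y - cB m) * theta m * F (xi_a m x y).

Definition pure_nash (F : R -> R) (m : market)
    (xy : strategyA * strategyB) : Prop :=
  let (x, y) := xy in
  feasibleA m x /\ feasibleB m y /\
  (forall x', feasibleA m x' -> profitA F m x' y <= profitA F m x y) /\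
  (forall y', feasibleB m y' -> profitB F m x y' <= profitB F m x y).

Definition uniform_cdf (x : R) : R :=
  if Rle_dec x 0 then 0 else if Rle_dec x 1 then x else 1.

(* Main.v *)
(* In each sub-market the strong firm faces the demand U((q + s + l - p) / l) and the
   weak one U((p - s - q) / l), where p and q are their prices and U is the uniform
   distribution function.  Both are thus monopolists against a linear demand with some
   choke price v, and the best price is max((c + v) / 2, v - l), unique as soon as v
   exceeds the unit cost c.  Profits are weighted sums over the two sub-markets, so a
   Nash equilibrium is a pair of mutual best responses in each of them, and these
   piecewise linear conditions have a single solution in Region II. *)
Require Import Defs.
From Stdlib Require Import Reals Lra.
Open Scope R_scope.

(** The uniform law is symmetric about 1/2; this gives the strong firm's demand the same form as the
    weak firm's. *)
Lemma uniform_cdf_complement (x : R) : 1 - uniform_cdf x = uniform_cdf (1 - x).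
Proof.
  unfold uniform_cdf.
  destruct (Rle_dec x 0), (Rle_dec x 1), (Rle_dec (1 - x) 0), (Rle_dec (1 - x) 1);
    lra.
Qed.

Lemma uniform_cdf_div (t l : R) :
  0 < l -> uniform_cdf (t / l) = Rmax 0 (Rmin t l) / l.
Proof.
  intros hl.
  assert (e : t = t / l * l) by (field; lra).
  set (u := t / l) in *; clearbody u; subst t.
  assert (e1 : 1 = l / l) by (field; lra).
  unfold uniform_cdf.
  destruct (Rle_dec u 0).
  - rewrite Rmax_left; [lra|].
    apply Rle_trans with (u * l); [apply Rmin_l|nra].
  - destruct (Rle_dec u 1).
    + rewrite Rmin_left, Rmax_right by nra. field; lra.
    + rewrite Rmin_right, Rmax_right by nra. exact e1.
Qed.

(* [v] is the choke price: demand vanishes from [v] on and is full up to [v - l]. *)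
Definition earnings (c v l x : R) : R := (x - c) * uniform_cdf ((v - x) / l).

Definition best_price (c v l x : R) : Prop :=
  c <= x /\ forall x', c <= x' -> earnings c v l x' <= earnings c v l x.

Lemma earnings_choked (c v l x : R) :
  0 < l -> v <= x -> earnings c v l x = 0.
Proof.
  intros hl hx. unfold earnings. rewrite uniform_cdf_div by exact hl.
  rewrite Rmax_left; [lra|].
  apply Rle_trans with (v - x); [apply Rmin_l|lra].
Qed.

(** Up to [v - l] demand is full and earnings rise with the price; from there to [v] they follow the
    parabola [(x - c) * (v - x) / l] with vertex [(c + v) / 2]. If the vertex lies below the kink
    [v - l], the kink is the peak. *)
Lemma earnings_lt_max (c v l x : R) :
  0 < l -> c < v -> c <= x -> x <> Rmax ((c + v) / 2) (v - l) ->
  earnings c v l x < earnings c v l (Rmax ((c + v) / 2) (v - l)).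
Proof.
  intros hl hv hx hne. unfold earnings.
  rewrite !uniform_cdf_div by exact hl.
  (* Only the two divisions by [l] are unfolded, to cancel them; [(c + v) / 2] stays intact. *)
  unfold Rdiv at 1 3. rewrite <- !Rmult_assoc.
  apply Rmult_lt_compat_r; [apply Rinv_0_lt_compat; exact hl|].
  destruct (Rle_dec (v - l) ((c + v) / 2)) as [h|h].
  - rewrite (Rmax_left _ (v - l)) in * by exact h.
    rewrite (Rmin_left (v - (c + v) / 2)), (Rmax_right 0 (v - (c + v) / 2)) by lra.
    (* This square is exactly the shortfall of [(x - c) * (v - x)] from its value at the vertex. *)
    assert (0 < (x - (c + v) / 2) * (x - (c + v) / 2)) by nra.
    unfold Rmax, Rmin; destruct (Rle_dec (v - x) l), (Rle_dec 0 _); nra.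
  - rewrite (Rmax_right _ (v - l)) in * by lra.
    rewrite (Rmin_right (v - (v - l))), (Rmax_right 0 l) by lra.
    unfold Rmax, Rmin; destruct (Rle_dec (v - x) l), (Rle_dec 0 _); nra.
Qed.

(** When [v <= c], every feasible price earns zero, so all of them are best. *)
Lemma best_price_iff (c v l x : R) :
  0 < l ->
  best_price c v l x <-> c <= x /\ (v <= c \/ x = Rmax ((c + v) / 2) (v - l)).
Proof.
  intros hl. split; intros [hx h]; (split; [exact hx|]).
  - destruct (Rle_lt_dec v c) as [hv|hv]; [left; exact hv|right].
    destruct (Req_dec x (Rmax ((c + v) / 2) (v - l))) as [e|hne]; [exact e|].
    exfalso. apply (Rlt_not_le _ _ (earnings_lt_max c v l x hl hv hx hne)), h.
    apply Rle_trans with ((c + v) / 2); [lra|apply Rmax_l].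
  - intros x' hx'. destruct (Rle_lt_dec v c) as [hv|hv].
    + rewrite !earnings_choked by lra. lra.
    + destruct h as [h|h]; [lra|].
      destruct (Req_dec x' x) as [e|hne]; [rewrite e; lra|].
      rewrite h in *. left. now apply earnings_lt_max.
Qed.

(* A firm with cost [c] is strong, its opponent with cost [k] is weak. *)
Definition submarket_nash (c k s l p q : R) : Prop :=
  best_price c (q + s + l) l p /\ best_price k (p - s) l q.

(** The prices solve the two vertex equations [p = (c + q + s + l) / 2] and [q = (k + p - s) / 2].
    The lower bound on [c - k] amounts to [k <= q] and to [q + s <= p], the upper one to [c <= p]
    and to [p - s - l <= q]. *)
Lemma submarket_nash_shared (c k s l p q : R) :
  0 < l -> s - l <= c - k <= s + 2 * l ->
  submarket_nash c k s l p q <->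
  p = 1 / 3 * (2 * c + k + s + 2 * l) /\ q = 1 / 3 * (c + 2 * k - s + l).
Proof.
  intros hl h. unfold submarket_nash. rewrite !best_price_iff by exact hl.
  unfold Rmax.
  destruct (Rle_dec ((c + (q + s + l)) / 2) _), (Rle_dec ((k + (p - s)) / 2) _);
    (split; [lra|intros [-> ->]; lra]).
Qed.

(** The strong firm prices at its kink [q + s] and serves everyone. The weak firm sells nothing,
    which is optimal only if its choke price [p - s] is at most [k]; with [k <= q] this forces
    [q = k]. *)
Lemma submarket_nash_captured (c k s l p q : R) :
  0 < l -> c - k <= s - l ->
  submarket_nash c k s l p q <-> p = k + s /\ q = k.
Proof.
  intros hl h. unfold submarket_nash. rewrite !best_price_iff by exact hl.
  unfold Rmax.
  destruct (Rle_dec ((c + (q + s + l)) / 2) _), (Rle_dec ((k + (p - s)) / 2) _);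
    (split; [lra|intros [-> ->]; lra]).
Qed.

(** Changing one price alone leaves the other term fixed, and the positive weight can be divided
    out. *)
Lemma weighted_best_prices_iff (c w w' v v' l l' x y : R) :
  0 < w -> 0 < w' ->
  (c <= x /\ c <= y) /\
  (forall x' y', c <= x' -> c <= y' ->
     w * earnings c v l x' + w' * earnings c v' l' y'
     <= w * earnings c v l x + w' * earnings c v' l' y) <->
  best_price c v l x /\ best_price c v' l' y.
Proof.
  intros hw hw'. split.
  - intros [[hx hy] h]. split; (split; [assumption|]).
    + intros x' hx'. specialize (h x' y hx' hy). nra.
    + intros y' hy'. specialize (h x y' hx hy'). nra.
  - intros [[hx hf] [hy hg]]. split; [now split|].
    intros x' y' hx' hy'. specialize (hf x' hx'). specialize (hg y' hy'). nra.
Qed.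

Lemma profitA_earnings (m : market) (x : strategyA) (y : strategyB) :
  0 < la m ->
  profitA uniform_cdf m x y =
  theta m * earnings (cA m) (pBa y + sa m + la m) (la m) (pAa x)
  + (1 - theta m) * earnings (cA m) (pBb y - sb m) (lb m) (pAb x).
Proof.
  intros hl. unfold profitA, earnings, xi_a, xi_b.
  rewrite uniform_cdf_complement.
  replace (1 - (pAa x - pBa y - sa m) / la m)
    with ((pBa y + sa m + la m - pAa x) / la m) by (field; lra).
  replace (pBb y - sb m - pAb x) with (pBb y - pAb x - sb m) by ring.
  ring.
Qed.

Lemma profitB_earnings (m : market) (x : strategyA) (y : strategyB) :
  0 < lb m ->
  profitB uniform_cdf m x y =
  (1 - theta m) * earnings (cB m) (pAb x + sb m + lb m) (lb m) (pBb y)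
  + theta m * earnings (cB m) (pAa x - sa m) (la m) (pBa y).
Proof.
  intros hl. unfold profitB, earnings, xi_a, xi_b.
  rewrite uniform_cdf_complement.
  replace (1 - (pBb y - pAb x - sb m) / lb m)
    with ((pAb x + sb m + lb m - pBb y) / lb m) by (field; lra).
  replace (pAa x - sa m - pBa y) with (pAa x - pBa y - sa m) by ring.
  ring.
Qed.

Lemma pure_nash_iff (m : market) (x : strategyA) (y : strategyB) :
  0 < theta m < 1 -> 0 < la m -> 0 < lb m ->
  pure_nash uniform_cdf m (x, y) <->
  submarket_nash (cA m) (cB m) (sa m) (la m) (pAa x) (pBa y) /\
  submarket_nash (cB m) (cA m) (sb m) (lb m) (pBb y) (pAb x).
Proof.
  intros ht hla hlb. unfold submarket_nash.
  pose proof (weighted_best_prices_iff (cA m) (theta m) (1 - theta m)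
    (pBa y + sa m + la m) (pBb y - sb m) (la m) (lb m) (pAa x) (pAb x)
    ltac:(lra) ltac:(lra)) as hA.
  pose proof (weighted_best_prices_iff (cB m) (1 - theta m) (theta m)
    (pAb x + sb m + lb m) (pAa x - sa m) (lb m) (la m) (pBb y) (pBa y)
    ltac:(lra) ltac:(lra)) as hB.
  split.
  - intros (fA & fB & nA & nB).
    destruct (proj1 hA) as [bAa bAb].
    { split; [exact fA|]. intros x1 x2 h1 h2.
      specialize (nA (StrategyA x1 x2) (conj h1 h2)).
      now rewrite !profitA_earnings in nA by exact hla. }
    destruct (proj1 hB) as [bBb bBa].
    { split; [exact fB|]. intros y1 y2 h1 h2.
      specialize (nB (StrategyB y1 y2) (conj h1 h2)).
      now rewrite !profitB_earnings in nB by exact hlb. }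
    tauto.
  - intros [[bAa bBa] [bBb bAb]].
    destruct (proj2 hA (conj bAa bAb)) as [fA nA].
    destruct (proj2 hB (conj bBb bBa)) as [fB nB].
    split; [exact fA|split; [exact fB|split]].
    + intros x' [h1 h2]. rewrite !profitA_earnings by exact hla. now apply nA.
    + intros y' [h1 h2]. rewrite !profitB_earnings by exact hlb. now apply nB.
Qed.

Theorem proposition4 (c_A c_B theta l_a s_a l_b s_b : R)
    (hcB : 0 <= c_B) (hcA : c_B <= c_A)
    (htheta : 0 < theta < 1)
    (hla : 0 < l_a) (hlb : 0 < l_b)
    (hsa : 0 <= s_a) (hsb : 0 <= s_b)
    (hII : Rmax (l_b - s_b) (s_a - l_a) <= c_A - c_B <= s_a + 2 * l_a) :
  unique
    (pure_nash uniform_cdf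
       {| cA := c_A; cB := c_B; theta := theta;
          la := l_a; sa := s_a; lb := l_b; sb := s_b |})
    ({| pAa := 1 / 3 * (2 * c_A + c_B + s_a + 2 * l_a);
        pAb := c_A |},
     {| pBb := c_A + s_b;
        pBa := 1 / 3 * (c_A + 2 * c_B - s_a + l_a) |}).
Proof.
  assert (h1 : l_b - s_b <= c_A - c_B)
    by (eapply Rle_trans; [apply Rmax_l|apply hII]).
  assert (h2 : s_a - l_a <= c_A - c_B)
    by (eapply Rle_trans; [apply Rmax_r|apply hII]).
  split.
  - apply pure_nash_iff; simpl; [exact htheta|exact hla|exact hlb|]. split.
    + apply submarket_nash_shared; lra.
    (* On beta firm B is strong, so the costs swap roles and the condition reads
       [c_B - c_A <= s_b - l_b]. *)
    + apply submarket_nash_captured; lra.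
  - intros [[x1 x2] [y1 y2]] hn.
    apply pure_nash_iff in hn; [|exact htheta|exact hla|exact hlb].
    destruct hn as [ha hb]; simpl in ha, hb.
    apply submarket_nash_shared in ha; [|lra..].
    apply submarket_nash_captured in hb; [|lra..].
    now destruct ha as [-> ->], hb as [-> ->].
Qed.
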